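(* Let $(M,\pi_0,\mathcal{N})$ be an orientable Poisson-Nijenhuis manifold, and put $\pi_1=\mathcal{N}\pi_0$. Then the modular vector field $X_{\mathcal{N}}$ of $(M,\pi_0,\mathcal{N})$ is hamiltonian relative to $\pi_0$, with hamiltonian equal to minus one half the trace of $\mathcal{N}$: $$X_{\mathcal{N}}=X^0_{-\frac12\operatorname{tr}\mathcal{N}},$$ where $X^0_h=\pi_0^\sharp\,\mathrm{d}h$ denotes the hamiltonian vector field of $h\in C^\infty(M)$ relative to $\pi_0$.
   Context: Everything is smooth. For a Poisson manifold $(M,\pi)$: $\{f,g\}=\pi(\mathrm{d}f,\mathrm{d}g)$, $\pi^\sharp:T^*M\to TM$ is defined by $\langle\beta,\pi^\sharp\alpha\rangle=\pi(\alpha,\beta)$, and the hamiltonian vector field of $h$ is $X_h=\pi^\sharp\mathrm{d}h=\{h,\cdot\}$. For a volume form $\mu$ on $M$, the divergence of a vector field $X$ is the function with $\mathcal{L}_X\mu=\operatorname{div}_\mu(X)\mu$, and the modular vector field of $\pi$ relative to $\mu$ is the vector field $X_\mu$ with $X_\mu(f)=\operatorname{div}_\mu(X_f)$ for all $f\in C^\infty(M)$. The bracket on 1-forms associated with a bivector $\pi$ is $[\alpha,\beta]_\pi=\mathcal{L}_{\pi^\sharp\alpha}\beta-\mathcal{L}_{\pi^\sharp\beta}\alpha-\mathrm{d}(\pi(\alpha,\beta))$. A Poisson-Nijenhuis manifold $(M,\pi_0,\mathcal{N})$ is a manifold $M$ with a Poisson structure $\pi_0$ and a $(1,1)$-tensor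 $\mathcal{N}:TM\to TM$ such that: (i) the Nijenhuis torsion vanishes, i.e. $\mathcal{N}[\mathcal{N}X,Y]+\mathcal{N}[X,\mathcal{N}Y]-\mathcal{N}^2[X,Y]-[\mathcal{N}X,\mathcal{N}Y]=0$ for all vector fields $X,Y$; (ii) $\mathcal{N}\pi_0^\sharp=\pi_0^\sharp\mathcal{N}^*$ ($\mathcal{N}^*$ is the transpose), so that $\pi_1=\mathcal{N}\pi_0$, defined by $\pi_1^\sharp=\mathcal{N}\pi_0^\sharp$, is a bivector field; (iii) $[\alpha,\beta]_{\pi_1}=[\mathcal{N}^*\alpha,\beta]_{\pi_0}+[\alpha,\mathcal{N}^*\beta]_{\pi_0}-\mathcal{N}^*[\alpha,\beta]_{\pi_0}$ for all 1-forms $\alpha,\beta$. Then $\pi_1$ is a Poisson tensor. Let $X^0_\mu$ and $X^1_\mu$ be the modular vector fields of $\pi_0$ and $\pi_1$ relative to a volume form $\mu$. The modular vector field of the Poisson-Nijenhuis manifold is $X_{\mathcal{N}}:=X^1_\mu-\mathcal{N}X^0_\mu$; it does not depend on the choice of $\mu$. *)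

(* Defs.v *)
From HB Require Import structures.
From mathcomp Require Import all_boot all_order all_algebra.
From mathcomp Require Import boolp classical_sets reals topology normedtype
  derive.

Set Implicit Arguments.
Unset Strict Implicit.
Unset Printing Implicit Defensive.

Import Order.TTheory GRing.Theory Num.Theory numFieldNormedType.Exports.

Local Open Scope classical_set_scope.
Local Open Scope ring_scope.

Section Euclidean.
Context {R : realType} {n : nat}.

(* [partials [:: i1; ...; ik] f] is d_i1 (... (d_ik f)). *)
Definition partials (s : seq 'I_n) (f : 'cV[R]_n -> R) : 'cV[R]_n -> R :=
  foldr (fun i g x => 'D_(delta_mx i 0) g x) f s.

(* C^oo on [A], which is always open below: every iterated partial derivative
   exists and is continuous at every point of [A]. *)
Definition smooth_on (A : set 'cV[R]_n) (f : 'cV[R]_n -> R) : Prop :=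
  forall (s : seq 'I_n) (x : 'cV[R]_n), A x ->
    {for x, continuous (partials s f)} /\
    forall i : 'I_n, derivable (partials s f) x (delta_mx i 0).

(* Jacobian matrix acting on column vectors ([jacobian] of derive.v acts on row
   vectors). *)
Definition jac (f : 'cV[R]_n -> 'cV[R]_n) (x : 'cV[R]_n) : 'M[R]_n :=
  \matrix_(i, j) 'D_(delta_mx j 0) (fun y => f y i 0) x.

End Euclidean.

(* [psi] is the inverse of [phi : dom -> cod]; the values of [phi] outside [dom]
   and of [psi] outside [cod] are junk. *)
Record chart (R : realType) (n : nat) (T : topologicalType) := Chart {
  dom : set T;
  cod : set 'cV[R]_n;
  phi : T -> 'cV[R]_n;
  psi : 'cV[R]_n -> T;
  dom_open : open dom;
  cod_open : open cod;
  phi_cod : forall p, dom p -> cod (phi p);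
  psi_dom : forall x, cod x -> dom (psi x);
  phiK : forall p, dom p -> psi (phi p) = p;
  psiK : forall x, cod x -> phi (psi x) = x;
  phi_continuous : forall p, dom p -> {for p, continuous phi};
  psi_continuous : forall x, cod x -> {for x, continuous psi}
}.

Record manifold (R : realType) (n : nat) := Manifold {
  carrier :> topologicalType;
  carrier_hausdorff : hausdorff_space carrier;
  carrier_second_countable : @second_countable carrier;
  atlas : set (chart R n carrier);
  atlas_cover : forall p, exists2 c, atlas c & dom c p;
  atlas_compat : forall c d, atlas c -> atlas d -> forall i : 'I_n,
    smooth_on (cod c `&` psi c @^-1` dom d) (fun x => phi d (psi c x) i 0)
}.

Section Tensors.
Context {R : realType} {n : nat} {M : manifold R n}.

(* A preferred chart around each point. The tangent space at [p] is 'cV[R]_n,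
   a vector being given by its components in the chart [chart_at p]; likewise
   every tensor at [p] is given by its components in [chart_at p]. All
   algebraic operations are then pointwise, and smoothness is tested on the
   components in every fixed chart, obtained with [to_chart] and [of_chart]. *)
Definition chart_at (p : M) : chart R n M := sval (cid2 (atlas_cover p)).

Definition vector_field := M -> 'cV[R]_n.
Definition one_form := M -> 'rV[R]_n.
(* [N p *m u] is the image of the tangent vector [u]. *)
Definition endo_field := M -> 'M[R]_n.
(* The entry (i, j) of [P p] is pi(dx_i, dx_j). *)
Definition bitensor_field := M -> 'M[R]_n.
(* Value at [p] on n tangent vectors. *)
Definition top_form := M -> ('I_n -> 'cV[R]_n) -> R.

(* The differential at [q] of the coordinate map of [c], from the tangent space
   at [q] to R^n, and its inverse. *)
Definition to_chart (c : chart R n M) (q : M) : 'M[R]_n :=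
  jac (fun x => phi c (psi (chart_at q) x)) (phi (chart_at q) q).
Definition of_chart (c : chart R n M) (q : M) : 'M[R]_n :=
  jac (fun x => phi (chart_at q) (psi c x)) (phi c q).

(* Components of tensor fields in the chart [c], as functions on [cod c]. *)
Definition loc_vector (c : chart R n M) (X : vector_field) (x : 'cV[R]_n) :
  'cV[R]_n := to_chart c (psi c x) *m X (psi c x).
Definition loc_form (c : chart R n M) (a : one_form) (x : 'cV[R]_n) :
  'rV[R]_n := a (psi c x) *m of_chart c (psi c x).
Definition loc_endo (c : chart R n M) (N : endo_field) (x : 'cV[R]_n) :
  'M[R]_n := to_chart c (psi c x) *m N (psi c x) *m of_chart c (psi c x).
Definition loc_bitensor (c : chart R n M) (P : bitensor_field) (x : 'cV[R]_n) :
  'M[R]_n := to_chart c (psi c x) *m P (psi c x) *m (to_chart c (psi c x))^T.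
Definition loc_top (c : chart R n M) (mu : top_form) (x : 'cV[R]_n)
    (v : 'I_n -> 'cV[R]_n) : R :=
  mu (psi c x) (fun i => of_chart c (psi c x) *m v i).

Definition smooth_fun (f : M -> R) : Prop :=
  forall c, atlas c -> smooth_on (cod c) (fun x => f (psi c x)).
Definition smooth_vector (X : vector_field) : Prop :=
  forall c, atlas c -> forall i, smooth_on (cod c) (fun x => loc_vector c X x i 0).
Definition smooth_form (a : one_form) : Prop :=
  forall c, atlas c -> forall j, smooth_on (cod c) (fun x => loc_form c a x 0 j).
Definition smooth_endo (N : endo_field) : Prop :=
  forall c, atlas c -> forall i j, smooth_on (cod c) (fun x => loc_endo c N x i j).
Definition smooth_bitensor (P : bitensor_field) : Prop :=
  forall c, atlas c -> forall i j,
    smooth_on (cod c) (fun x => loc_bitensor c P x i j).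
Definition smooth_top (mu : top_form) : Prop :=
  forall c, atlas c -> forall v, smooth_on (cod c) (fun x => loc_top c mu x v).

Definition pairing (a : 'rV[R]_n) (u : 'cV[R]_n) : R := (a *m u) 0 0.

Definition diff_fun (f : M -> R) : one_form := fun p =>
  let c := chart_at p in
  \row_j 'D_(delta_mx j 0) (fun x => f (psi c x)) (phi c p).

(* The differential operators below are given at [p] by their classical
   coordinate formulas, in the chart [chart_at p]. *)

(* [X, Y]^i = X^j d_j Y^i - Y^j d_j X^i *)
Definition lie_bracket (X Y : vector_field) : vector_field := fun p =>
  let c := chart_at p in
  'D_(X p) (loc_vector c Y) (phi c p) - 'D_(Y p) (loc_vector c X) (phi c p).

(* (L_X a)_j = X^i d_i a_j + a_i d_j X^i *)
Definition lie_form (X : vector_field) (a : one_form) : one_form := fun p =>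
  let c := chart_at p in
  'D_(X p) (loc_form c a) (phi c p) + a p *m jac (loc_vector c X) (phi c p).

(* (L_X mu)(v_1, ..., v_n) = X(mu(v_1, ..., v_n))
     + sum_i mu(v_1, ..., DX v_i, ..., v_n), with the v_i constant in the chart *)
Definition lie_top (X : vector_field) (mu : top_form) : top_form := fun p v =>
  let c := chart_at p in
  'D_(X p) (fun x => loc_top c mu x v) (phi c p)
  + \sum_i mu p [eta v with i |-> jac (loc_vector c X) (phi c p) *m v i].

Definition volume_form (mu : top_form) : Prop :=
  [/\ smooth_top mu,
      forall p v i a (u w : 'cV[R]_n),
        mu p [eta v with i |-> a *: u + w] =
        a * mu p [eta v with i |-> u] + mu p [eta v with i |-> w],
      forall p (v : 'I_n -> 'cV[R]_n) i j, i != j -> v i = v j -> mu p v = 0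
    & forall p, exists v, mu p v != 0].

(* pi(a, b) *)
Definition bieval (P : 'M[R]_n) (a b : 'rV[R]_n) : R := (a *m P *m b^T) 0 0.

(* The map pi^sharp, with <b, pi^sharp a> = pi(a, b). *)
Definition sharp (P : 'M[R]_n) (a : 'rV[R]_n) : 'cV[R]_n := (a *m P)^T.

Lemma sharpP (P : 'M[R]_n) (a b : 'rV[R]_n) :
  pairing b (sharp P a) = bieval P a b.
Proof.
by rewrite /pairing /sharp /bieval -[b in LHS]trmxK -trmx_mul mxE.
Qed.

Definition poisson_bracket (P : bitensor_field) (f g : M -> R) : M -> R :=
  fun p => bieval (P p) (diff_fun f p) (diff_fun g p).

Definition ham_field (P : bitensor_field) (h : M -> R) : vector_field :=
  fun p => sharp (P p) (diff_fun h p).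

Definition poisson (P : bitensor_field) : Prop :=
  [/\ smooth_bitensor P,
      forall p a b, bieval (P p) a b = - bieval (P p) b a
    & forall f g h, smooth_fun f -> smooth_fun g -> smooth_fun h -> forall p,
        poisson_bracket P f (poisson_bracket P g h) p
        + poisson_bracket P g (poisson_bracket P h f) p
        + poisson_bracket P h (poisson_bracket P f g) p = 0].

Definition is_divergence (mu : top_form) (X : vector_field) (g : M -> R) : Prop :=
  forall p v, lie_top X mu p v = g p * mu p v.

Definition modular_field (P : bitensor_field) (mu : top_form)
    (X : vector_field) : Prop :=
  smooth_vector X /\
  forall f, smooth_fun f ->
    is_divergence mu (ham_field P f) (fun p => pairing (diff_fun f p) (X p)).

(* The bracket [a, b]_pi on 1-forms. *)
Definition form_bracket (P : bitensor_field) (a b : one_form) : one_form :=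
  fun p => lie_form (fun q => sharp (P q) (a q)) b p
           - lie_form (fun q => sharp (P q) (b q)) a p
           - diff_fun (fun q => bieval (P q) (a q) (b q)) p.

Definition app_vector (N : endo_field) (X : vector_field) : vector_field :=
  fun p => N p *m X p.
Definition app_form (N : endo_field) (a : one_form) : one_form :=
  fun p => a p *m N p.

(* N pi, characterized by [sharp_endo_bitensor]. *)
Definition endo_bitensor (N : endo_field) (P : bitensor_field) :
  bitensor_field := fun p => P p *m (N p)^T.

Lemma sharp_endo_bitensor (N : endo_field) (P : bitensor_field) p a :
  sharp (endo_bitensor N P p) a = N p *m sharp (P p) a.
Proof. by rewrite /sharp /endo_bitensor mulmxA trmx_mul trmxK. Qed.

Definition torsion_free (N : endo_field) : Prop :=
  forall X Y, smooth_vector X -> smooth_vector Y -> forall p,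
    N p *m lie_bracket (app_vector N X) Y p
    + N p *m lie_bracket X (app_vector N Y) p
    - N p *m (N p *m lie_bracket X Y p)
    - lie_bracket (app_vector N X) (app_vector N Y) p = 0.

Definition poisson_nijenhuis (P : bitensor_field) (N : endo_field) : Prop :=
  [/\ poisson P,
      smooth_endo N,
      torsion_free N,
      forall p a, N p *m sharp (P p) a = sharp (P p) (a *m N p)
    & forall a b, smooth_form a -> smooth_form b -> forall p,
        form_bracket (endo_bitensor N P) a b p =
        form_bracket P (app_form N a) b p + form_bracket P a (app_form N b) p
        - app_form N (form_bracket P a b) p].

Definition trace_fun (N : endo_field) : M -> R := fun p => \tr (N p).

End Tensors.

Arguments vector_field {R n} M.
Arguments one_form {R n} M.
Arguments endo_field {R n} M.
Arguments bitensor_field {R n} M.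
Arguments top_form {R n} M.

(* Main.v *)
Require Import Defs.
From mathcomp Require Import all_boot all_order all_algebra.
From mathcomp Require Import reals.
From mathcomp Require Import boolp classical_sets functions topology normedtype.
From mathcomp Require Import derive sequences exp realfun.
From mathcomp Require Import ring lra.

Set Implicit Arguments.
Unset Strict Implicit.
Unset Printing Implicit Defensive.
Import Order.TTheory GRing.Theory Num.Theory numFieldNormedType.Exports.
Local Open Scope classical_set_scope.
Local Open Scope ring_scope.

(** Why the theorem holds. Work at a point p in the coordinates of the chart
    [chart_at p], write d_i for the partial derivatives at p, P for the matrix
    of pi_0 and B for the matrix of N.

    Both modular fields are computed by testing the divergence on coordinate
    functions: if mu = rho dx_1 ... dx_n, then
      X^k = sum_i d_i P_ki + sum_i P_ki d_i (log rho)
    ([modular_fieldE]). The term in rho is linear over functions in the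
    bivector, so it cancels in X^1 - N X^0. Since the matrix of pi_1 is the
    product B P, the Leibniz rule leaves ([modular_difference])
      (X^1 - N X^0)^k = sum_{i,l} (d_i B_kl) P_li.
    On the other side, the k-th component of the hamiltonian field of
    - 1/2 tr N is 1/2 sum_i P_ki d_i (tr B). So everything reduces to
      2 sum_{i,l} (d_i B_kl) P_li = sum_i P_ki d_i (tr B),
    which is [nijenhuis_trace]. It follows from the compatibility of the two
    brackets of 1-forms alone: evaluate that condition on dx_k and dx_b, take
    the component along dx_b, and sum over b. All the terms containing a
    derivative of P, and those containing the divergence of the columns of B,
    cancel in pairs because P is antisymmetric ([trace_identity]).

    Vector fields, forms and functions are global, so the coordinate functions
    of a chart have to be replaced by smooth functions on M that agree with them
    near p ([coordinate_extension]): they are cut off by a bump function made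
    from exp (- 1 / t), and extended by zero, which is smooth because M is
    Hausdorff and the image of a compact box is therefore closed. That the
    result is smooth in every chart, and that the components of a differential
    change as they should, rests on the chain rule for functions with continuous
    partial derivatives ([is_derive_chain]), which is derived here from the mean
    value theorem. *)

(** * The chain rule *)

Section Calculus.
Context {R : realType}.

Lemma cvg_col (n : nat) (T : Type) (F : set_system T) (FF : Filter F)
    (g : T -> 'cV[R]_n) (y : 'cV[R]_n) :
  (forall i, g t i 0 @[t --> F] --> y i 0) -> g @ F --> y.
Proof.
move=> h; apply/cvg_ballP => e e0.
near=> t; split=> // i j; rewrite (ord1 j); move: i; near: t.
apply: filter_forall => i.
by have /cvg_ballP := h i; apply.
Unshelve. all: by end_near. Qed.

Lemma is_derive_line (V : normedModType R) (f : V -> R) (z v : V) (t : R) :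
  derivable f (t *: v + z) v ->
  is_derive t 1 (fun s : R => f (s *: v + z)) ('D_v f (t *: v + z)).
Proof.
have E : (fun h : R => h^-1 *: (f ((h *: 1 + t) *: v + z) - f (t *: v + z)))
       = (fun h : R => h^-1 *: (f (h *: v + (t *: v + z)) - f (t *: v + z))).
  apply/funext => h; congr (_ *: (f _ - _)).
  by rewrite scalerDl -addrA [_%:A]mulr1.
by move=> df; apply: DeriveDef; rewrite /derivable /derive /= E.
Qed.

(** The sign of [d] is arbitrary, which is what a telescoping sum over
    coordinate increments requires. *)
Lemma MVT_line (V : normedModType R) (f : V -> R) (z v : V) (d : R) :
  (forall t : R, `|t| <= `|d| -> derivable f (t *: v + z) v) ->
  exists2 t : R, `|t| <= `|d| &
    f (d *: v + z) - f z = 'D_v f (t *: v + z) * d.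
Proof.
move=> df; have dl (t : R) : `|t| <= `|d| ->
    is_derive t 1 (fun s : R => f (s *: v + z)) ('D_v f (t *: v + z)).
  by move=> td; apply: is_derive_line; exact: df.
have cont (a b : R) : (forall t : R, t \in `[a, b]%R -> `|t| <= `|d|) ->
    {within `[a, b], continuous (fun s : R => f (s *: v + z))}.
  move=> ab; apply: derivable_within_continuous => t /ab td.
  by have [] := dl t td.
case: (leP 0 d) => d0.
- have sub (t : R) : t \in `[0, d]%R -> `|t| <= `|d|.
    by rewrite in_itv /= => /andP[t0 td]; rewrite !ger0_norm// (le_trans t0).
  have [||c c0d] := @MVT_segment R (fun s => f (s *: v + z))
      (fun s => 'D_v f (s *: v + z)) 0 d d0.
  + by move=> t td; apply/dl/sub/(subset_itv_oo_cc td).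
  + exact: cont.
  by rewrite scale0r add0r subr0 => e; exists c => //; exact: sub.
- have sub (t : R) : t \in `[d, 0]%R -> `|t| <= `|d|.
    by rewrite in_itv /= => /andP[td t0]; rewrite ler0_norm// ltr0_norm// lerN2.
  have [||c c0d] := @MVT_segment R (fun s => f (s *: v + z))
      (fun s => 'D_v f (s *: v + z)) d 0 (ltW d0).
  + by move=> t td; apply/dl/sub/(subset_itv_oo_cc td).
  + exact: cont.
  rewrite scale0r add0r sub0r => e; exists c; first exact: sub.
  by apply: oppr_inj; rewrite opprB e mulrN.
Qed.

Section Chain.
Context {n : nat}.
Implicit Types (f : 'cV[R]_n -> R) (x y : 'cV[R]_n).
Local Notation e_ k := (delta_mx k 0 : 'cV[R]_n).

(** Partial derivatives exist around [x], and are continuous at [x] itself. *)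
Definition C1_at f x := forall k,
  (\forall y \near x, derivable f y (e_ k)) /\
  {for x, continuous (fun y => 'D_(e_ k) f y)}.

(** The first [k] coordinates of [y] followed by the others of [x]: the broken
    line from [x] to [y] whose segments are parallel to the axes. *)
Let mix x y (k : nat) : 'cV[R]_n := \col_i if (i < k)%N then y i 0 else x i 0.

(** The difference quotient of [f] along the [k]-th segment of the broken line.
    On a degenerate segment it is the partial derivative, so that it is
    continuous in [y] at [x]. *)
Let slope f x (k : 'I_n) y : R :=
  if y k 0 == x k 0 then 'D_(e_ k) f x
  else (f (mix x y k.+1) - f (mix x y k)) / (y k 0 - x k 0).

Let mixS x y (k : 'I_n) :
  mix x y k.+1 = (y k 0 - x k 0) *: e_ k + mix x y k.
Proof.
apply/colP => i; rewrite !mxE ltnS leq_eqVlt eqxx andbT.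
rewrite -(inj_eq val_inj); case: (val i =P val k) => [/val_inj ->|_] /=.
  by rewrite ltnn mulr1 subrK.
by rewrite mulr0 add0r.
Qed.

Let slope_sum f x y : f y - f x = \sum_k slope f x k y * (y k 0 - x k 0).
Proof.
have -> : f y = f (mix x y n).
  by congr f; apply/colP => i; rewrite mxE ltn_ord.
have -> : f x = f (mix x y 0) by congr f; apply/colP => i; rewrite mxE.
rewrite -(telescope_sumr (fun k => f (mix x y k)) (leq0n n)) big_mkord.
apply: eq_bigr => k _; rewrite /slope; case: eqP => [e|/eqP e].
  by rewrite mixS e subrr scale0r add0r mulr0 subrr.
by rewrite divfK// subr_eq0.
Qed.

(** By the mean value theorem on the segment, the quotient is a partial
    derivative at a point that is no further from [x] than [y] is. *)
Let slope_cvg f x k : C1_at f x -> slope f x k y @[y --> x] --> 'D_(e_ k) f x.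
Proof.
move=> /(_ k)[df cf]; apply/(@cvgrPdist_le _ _ _ (nbhs x) (nbhs_filter x)) => e e0.
have {}cf := (@cvgrPdist_le _ _ _ (nbhs x) (nbhs_filter x) _ _).1 cf _ e0.
have dc := @filterI _ _ (nbhs_filter x) _ _ df cf.
have [d /= d0 dP] := (nbhs_ballP _ _).1 dc.
apply/nbhs_ballP; exists d => //= y [_ xy].
rewrite /slope; case: eqP => [_|/eqP yx]; first by rewrite subrr normr0 ltW.
have inb (t : R) : `|t| <= `|y k 0 - x k 0| -> ball x d (t *: e_ k + mix x y k).
  move=> ht; split=> // i j; rewrite (ord1 j) !mxE eqxx andbT.
  case: (i =P k) => [->|_].
    rewrite ltnn mulr1 /ball /= opprD addrCA subrr addr0 normrN.
    by apply: (le_lt_trans ht); rewrite distrC; apply: xy.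
  rewrite mulr0 add0r; case: ifP => _; first exact: xy.
  exact: ballxx.
rewrite mixS.
have [|t ht ->] := @MVT_line _ f (mix x y k) (e_ k) (y k 0 - x k 0).
  by move=> t ht; have [] := dP _ (inb t ht).
rewrite mulfK ?subr_eq0//.
by have [] := dP _ (inb t ht).
Qed.

Lemma derivable_cvg_line (V W : normedModType R) (g : V -> W) (a v : V) :
  derivable g a v -> g (h *: v + a) @[h --> (0 : R)^'] --> g a.
Proof.
move=> /derivable1P/derivable1_diffP/differentiable_continuous.
by move=> /continuous_withinNx; rewrite scale0r add0r.
Qed.

(** The increment of [f] is a sum of slopes times coordinate increments, and the
    slopes converge; so the difference quotients of the composite converge
    without any appeal to a Frechet derivative. *)
Lemma is_derive_chain (V : normedModType R) f (g : V -> 'cV[R]_n) (a v : V)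
    (dg : 'I_n -> R) :
  C1_at f (g a) -> (forall k, is_derive a v (fun y : V => g y k 0) (dg k)) ->
  is_derive a v (fun y : V => f (g y)) (\sum_k 'D_(e_ k) f (g a) * dg k).
Proof.
move=> C1 dgk.
have L : h^-1 *: (f (g (h *: v + a)) - f (g a)) @[h --> (0 : R)^'] -->
    \sum_k 'D_(e_ k) f (g a) * dg k.
  have -> : (fun h : R => h^-1 *: (f (g (h *: v + a)) - f (g a))) =
      (fun h : R => \sum_k slope f (g a) k (g (h *: v + a)) *
        (h^-1 *: (g (h *: v + a) k 0 - g a k 0))).
    apply/funext => h; rewrite slope_sum scaler_sumr.
    by apply: eq_bigr => k _; rewrite [RHS]mulrCA.
  apply: cvg_big => [|k _]; first exact: add_continuous.
  apply: cvgM; last first.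
    by have [+ <-] := dgk k; exact.
  apply: (@cvg_comp _ _ _ (fun h => g (h *: v + a)) (slope f (g a) k) _
     (nbhs (g a))); last exact: slope_cvg.
  by apply: cvg_col => i; have [+ _] := dgk i; exact: derivable_cvg_line.
apply: DeriveDef; last exact: cvg_lim L.
by apply/cvg_ex; exists (\sum_k 'D_(e_ k) f (g a) * dg k).
Qed.

End Chain.
End Calculus.

(** * Smooth functions of several variables *)

Section Smooth.
Context {R : realType} {n : nat}.
Implicit Types (f g : 'cV[R]_n -> R) (A B : set 'cV[R]_n).
Local Notation e_ k := (delta_mx k 0 : 'cV[R]_n).

Lemma open_near (T : topologicalType) (A : set T) (x : T) (P : T -> Prop) :
  open A -> A x -> (forall y, A y -> P y) -> \forall y \near x, P y.
Proof.
move=> oA Ax AP; apply: (@filterS _ _ (nbhs_filter x) A) => //.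
exact: open_nbhs_nbhs.
Qed.

Lemma continuous_for_ext (T U : topologicalType) (f g : T -> U) (x : T) :
  (\forall y \near x, f y = g y) -> {for x, continuous f} ->
  {for x, continuous g}.
Proof.
move=> fg cf; have e := nbhs_singleton fg.
change (g @ x --> g x); rewrite -e.
apply: cvg_trans cf; apply: near_eq_cvg.
exact: (@filterS _ _ (nbhs_filter x) _ _ _ fg).
Qed.

(** The order of differentiation is reversed with respect to [partials]: the
    first derivative is taken innermost. In this form the class C^k.+1 is
    described by the class C^k of the first partial derivatives, which is what
    inductions on [k] use. *)
Fixpoint Ck (k : nat) A f : Prop :=
  (forall x, A x -> {for x, continuous f}) /\
  if k is k'.+1 then
    forall i, (forall x, A x -> derivable f x (e_ i)) /\
      Ck k' A (fun x => 'D_(e_ i) f x)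
  else True.

Lemma Ck_continuous k A f x : Ck k A f -> A x -> {for x, continuous f}.
Proof. by case: k => [|k] [+ _]; exact. Qed.

Lemma partials_rcons s i f :
  partials (rcons s i) f = partials s (fun x => 'D_(e_ i) f x).
Proof. by rewrite /partials foldr_rcons. Qed.

Lemma smooth_onP A f : smooth_on A f <-> forall k, Ck k A f.
Proof.
split=> [sf k|].
  elim: k f sf => [|k IH] f sf;
    (split; first by move=> x Ax; have [] := sf [::] x Ax) => // i.
  split=> [x Ax|]; first by have [_ ] := sf [::] x Ax; exact.
  by apply: IH => s x Ax; rewrite -partials_rcons; exact: sf.
move=> cf s; elim/last_ind: s f cf => [|s i IH] f cf x Ax.
  split; first exact: Ck_continuous (cf 0) Ax.
  by move=> i; have [_ /(_ i)[+ _]] := cf 1; exact.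
rewrite partials_rcons; apply: IH => // k.
by have [_ /(_ i)[]] := cf k.+1.
Qed.

Lemma smooth_Ck k A f : smooth_on A f -> Ck k A f.
Proof. by move=> /smooth_onP. Qed.

Lemma CkW k A f : Ck k.+1 A f -> Ck k A f.
Proof.
elim: k f => [|k IH] f [cf df]; split=> // i.
by have [dfi Di] := df i; split=> //; exact: IH.
Qed.

(** Openness of [A] matters: derivatives at a point of [A] then depend only on
    the values on [A]. *)
Lemma Ck_ext k A f g : open A -> (forall x, A x -> f x = g x) ->
  Ck k A f -> Ck k A g.
Proof.
move=> oA; elim: k f g => [|k IH] f g fg [cf df]; (split=> [x Ax|//]).
- by apply: continuous_for_ext (cf x Ax); exact: open_near fg.
- by apply: continuous_for_ext (cf x Ax); exact: open_near fg.
move=> i; have [dfi Dfi] := df i; split=> [x Ax|].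
  by apply: near_eq_derivable (dfi x Ax); exact: open_near fg.
apply: IH Dfi => x Ax.
by apply: near_eq_derive; exact: open_near fg.
Qed.

Lemma Ck_cst k A (c : R) : open A -> Ck k A (fun=> c).
Proof.
move=> oA; elim: k c => [|k IH] c; (split=> [x Ax|//]); try exact: cst_continuous.
move=> i; split=> [x Ax|]; first exact: derivable_cst.
by apply: (Ck_ext oA _ (IH 0)) => x _; rewrite derive_cst.
Qed.

Lemma CkD k A f g : open A -> Ck k A f -> Ck k A g ->
  Ck k A (fun x => f x + g x).
Proof.
move=> oA; elim: k f g => [|k IH] f g [cf df] [cg dg]; (split=> [x Ax|//]).
- by apply: continuousD; [exact: cf|exact: cg].
- by apply: continuousD; [exact: cf|exact: cg].
move=> i; have [dfi Df] := df i; have [dgi Dg] := dg i; split=> [x Ax|].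
  by apply: derivableD; [exact: dfi|exact: dgi].
apply: (Ck_ext oA _ (IH _ _ Df Dg)) => x Ax.
by rewrite -deriveD //; [exact: dfi|exact: dgi].
Qed.

Lemma CkM k A f g : open A -> Ck k A f -> Ck k A g ->
  Ck k A (fun x => f x * g x).
Proof.
move=> oA; elim: k f g => [|k IH] f g kf kg; (split=> [x Ax|//]).
- by apply: continuousM; [exact: Ck_continuous kf Ax|exact: Ck_continuous kg Ax].
- by apply: continuousM; [exact: Ck_continuous kf Ax|exact: Ck_continuous kg Ax].
move=> i; have [_ /(_ i)[dfi Df]] := kf; have [_ /(_ i)[dgi Dg]] := kg.
split=> [x Ax|].
  by apply: derivableM; [exact: dfi|exact: dgi].
apply: (Ck_ext oA _ (CkD oA (IH _ _ (CkW kf) Dg) (IH _ _ (CkW kg) Df))) => x Ax.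
by rewrite -[LHS]deriveM //; [exact: dfi|exact: dgi].
Qed.

Lemma Ck_sum k A (I : Type) (r : seq I) (F : I -> 'cV[R]_n -> R) : open A ->
  (forall j, Ck k A (F j)) -> Ck k A (fun x => \sum_(j <- r) F j x).
Proof.
move=> oA kF; elim: r => [|j r IH].
  by apply: (Ck_ext oA _ (Ck_cst k 0 oA)) => x _; rewrite big_nil.
by apply: (Ck_ext oA _ (CkD oA (kF j) IH)) => x _; rewrite big_cons.
Qed.

Lemma is_derive_coord (x v : 'cV[R]_n) (i : 'I_n) :
  is_derive x v (fun y : 'cV[R]_n => y i 0) (v i 0).
Proof.
have E : \forall h \near (0 : R)^',
    v i 0 = h^-1 *: ((h *: v + x) i 0 - x i 0) :> R.
  apply: filterS (nbhs_dnbhs_neq _) => h h0.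
  by rewrite !mxE addrK [RHS]mulrA mulVf// mul1r.
have L : h^-1 *: ((h *: v + x) i 0 - x i 0) @[h --> (0 : R)^'] --> v i 0.
  by apply: cvg_trans (near_eq_cvg E) _; exact: cvg_cst.
by apply: DeriveDef; [apply/cvg_ex; exists (v i 0)|exact: cvg_lim L].
Qed.

Lemma derive_coord (x v : 'cV[R]_n) (i : 'I_n) :
  'D_v (fun y : 'cV[R]_n => y i 0) x = v i 0.
Proof. by have [] := is_derive_coord x v i. Qed.

Lemma Ck_coord k A (i : 'I_n) : open A -> Ck k A (fun x => x i 0).
Proof.
move=> oA; case: k => [|k]; (split=> [x Ax|//]); try exact: coord_continuous.
move=> j; split=> [x _|]; first by have [] := is_derive_coord x (e_ j) i.
apply: (Ck_ext oA _ (Ck_cst k (e_ j i 0) oA)) => x _.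
by rewrite derive_coord.
Qed.

Lemma Ck_C1_at k A f x : open A -> A x -> Ck k.+1 A f -> C1_at f x.
Proof.
move=> oA Ax [_ df] i; have [dfi Dfi] := df i; split.
  exact: open_near dfi.
exact: Ck_continuous Dfi Ax.
Qed.

(** Induction on [k]: the partial derivatives of the composite are sums of
    products of composites of lower order. *)
Lemma Ck_comp k A B f (g : 'cV[R]_n -> 'cV[R]_n) : open A -> open B ->
  (forall x, A x -> B (g x)) -> Ck k B f ->
  (forall i, Ck k A (fun x => g x i 0)) -> Ck k A (fun x => f (g x)).
Proof.
move=> oA oB gAB.
have cont k' f' : Ck k' B f' -> (forall i, Ck k' A (fun x => g x i 0)) ->
    forall x, A x -> {for x, continuous (fun x => f' (g x))}.
  move=> kf kg x Ax.
  have cg : {for x, continuous g}.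
    apply: (@cvg_col _ _ _ _ (nbhs_filter x)) => i.
    exact: Ck_continuous (kg i) Ax.
  exact: continuous_comp cg (Ck_continuous kf (gAB _ Ax)).
elim: k f => [|k IH] f kf kg; (split; first exact: cont kf kg); first by [].
move=> i.
have D x : A x -> is_derive x (e_ i) (fun y => f (g y))
    (\sum_j 'D_(e_ j) f (g x) * 'D_(e_ i) (fun y => g y j 0) x).
  move=> Ax; apply: is_derive_chain; first exact: Ck_C1_at (gAB _ Ax) kf.
  by move=> j; apply: derivableP; have [_ /(_ i)[+ _]] := kg j; exact.
split=> [x /D[]//|].
have [_ df] := kf.
apply: (@Ck_ext _ _ (fun x =>
    \sum_j 'D_(e_ j) f (g x) * 'D_(e_ i) (fun y => g y j 0) x)) => //.
  by move=> x /D[].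
apply: Ck_sum => // j; apply: CkM => //; last first.
  by have [_ /(_ i)[]] := kg j.
have [_ Dj] := df j.
exact: (IH (fun y => 'D_(e_ j) f y) Dj (fun l => CkW (kg l))).
Qed.

Lemma is_derive_comp1 (V : normedModType R) (h : R -> R) (u : V -> R)
    (a v : V) (dh du : R) :
  is_derive (u a) 1 h dh -> is_derive a v u du ->
  is_derive a v (fun x => h (u x)) (dh * du).
Proof.
move=> Dh [du1 <-].
have line (w : V -> R) : derivable w a v ->
    is_derive (0 : R) 1 (fun t : R => w (t *: v + a)) ('D_v w a).
  by move=> dw; have := @is_derive_line _ _ w a v 0; rewrite scale0r add0r; exact.
have Dh' : is_derive (u (0 *: v + a)) 1 h dh by rewrite scale0r add0r.
have [dc Dc] := @is_derive1_comp _ h (fun t : R => u (t *: v + a)) 0 _ _ Dh'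
  (line u du1).
have dhu : derivable (fun x => h (u x)) a v by apply/derivable1P.
by apply: DeriveDef => //; have [_ <-] := line _ dhu.
Qed.

(** One-variable functions enter through a family [F] stable under derivation,
    instead of through a notion of smoothness on the line. *)
Lemma Ck_comp_family (F : set (R -> R)) (D : set R) A u :
  (forall h, F h -> exists2 h', F h' &
     forall t, D t -> is_derive t 1 h (h' t)) ->
  open A -> (forall x, A x -> D (u x)) -> (forall k, Ck k A u) ->
  forall k h, F h -> Ck k A (fun x => h (u x)).
Proof.
move=> FD oA uAD ku k.
have cont h : F h -> forall x, A x -> {for x, continuous (fun y => h (u y))}.
  move=> Fh x Ax; have [h' _ Dh] := FD h Fh.
  apply: continuous_comp (Ck_continuous (ku 0%N) Ax) _.
  have [dh _] := Dh _ (uAD _ Ax).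
  by apply: differentiable_continuous; apply/derivable1_diffP.
elim: k => [|k IH] h Fh; (split; first exact: cont); first by [].
move=> i; have [h' Fh' Dh] := FD h Fh.
have [_ /(_ i)[du Du]] := ku k.+1.
have Dhu x : A x -> is_derive x (e_ i) (fun y => h (u y))
    (h' (u x) * 'D_(e_ i) u x).
  move=> Ax; apply: is_derive_comp1; first exact/Dh/uAD.
  by apply: derivableP; exact: du.
split=> [x /Dhu[]//|].
apply: (@Ck_ext _ _ (fun x => h' (u x) * 'D_(e_ i) u x)) => //.
  by move=> x /Dhu[].
by apply: CkM => //; exact: IH.
Qed.

End Smooth.

(** * Bump functions *)

Section Bump.
Context {R : realType}.
Implicit Types (p : {poly R}) (t : R).

(** The functions p(1/t) exp (- 1/t), extended by zero to t <= 0, for [p] a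
    polynomial. They form a family stable under derivation. *)
Definition flat p t : R := if t <= 0 then 0 else p.[t^-1] * expR (- t^-1).

Lemma is_derive_inv t : t != 0 -> is_derive t 1 (fun s : R => s^-1) (- t ^- 2).
Proof.
move=> t0; have did : derivable (fun s : R => s) t 1 by exact: derivable_id.
apply: DeriveDef; first exact: (@derivableV _ _ (fun s : R => s) _ _ t0 did).
by rewrite (@deriveV _ _ (fun s : R => s) _ _ t0 did) derive_id [LHS]mulr1.
Qed.

(** With s = 1/t, each s^i exp (- s) is at most i!. *)
Lemma flat_bounded p : exists2 C, 0 <= C & forall t, `|flat p t| <= C.
Proof.
(* The bound i! on s^i exp (- s), weighted by the coefficients of [p]. *)
exists (\sum_(i < size p) `|p`_i| * i`!%:R).
  by apply: sumr_ge0 => i _; rewrite mulr_ge0.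
move=> t; rewrite /flat; case: ifPn => [_|].
  by rewrite normr0; apply: sumr_ge0 => i _; rewrite mulr_ge0.
rewrite -ltNge => t0; set s := t^-1; have s0 : 0 < s by rewrite invr_gt0.
rewrite horner_coef mulr_suml (le_trans (ler_norm_sum _ _ _))//.
apply: ler_sum => i _; rewrite -mulrA normrM ler_wpM2l//.
rewrite ger0_norm ?mulr_ge0 ?exprn_ge0 ?expR_ge0 ?(ltW s0)//.
rewrite expRN ler_pdivrMr ?expR_gt0//.
case: (val i) => [|j].
  by rewrite expr0 mul1r ltW// pexpR_gt1.
rewrite -ler_pdivrMl ?ltr0n ?fact_gt0// mulrC.
by rewrite (le_trans _ (expR_ge1Dxn j (ltW s0)))// lerDr.
Qed.

(** The chain rule turns d/dt into - s^2 d/ds, where s = 1/t. *)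
Let flat_deriv p : {poly R} := 'X^2 * (p - p^`()).

(** The only delicate point is 0. There [flat p] is t^2 times the bounded
    function [flat ('X^2 * p)], hence has derivative zero. *)
Lemma is_derive_flat p t : is_derive t 1 (flat p) (flat (flat_deriv p) t).
Proof.
have [t0|t0|->] := ltgtP t 0.
- rewrite [X in is_derive _ _ _ X]/flat (ltW t0).
  apply: near_eq_is_derive (is_derive_cst 0 t 1).
  near=> s; rewrite /flat ifT//; apply: ltW; near: s.
  exact: lt_nbhsl.
- have tn0 : t != 0 by rewrite gt_eqF.
  rewrite [X in is_derive _ _ _ X]/flat leNgt t0 /=.
  pose g (s : R) := p.[s] * expR (- s).
  have Dg : is_derive (t^-1) 1 g ((p^`()).[t^-1] * expR (- t^-1)
                                  - p.[t^-1] * expR (- t^-1)).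
    have De : is_derive (t^-1) 1 (fun s : R => expR (- s)) (expR (- t^-1) * -1).
      exact: is_derive1_comp.
    have Dp := is_derive_poly p t^-1.
    apply: is_derive_eq (is_deriveM Dp De) _.
    rewrite -[p.[_] *: _]/(_ * _) -[_ *: _.[_]]/(_ * _); ring.
  have := is_derive1_comp Dg (is_derive_inv tn0).
  move=> D; apply: is_derive_eq (near_eq_is_derive _ D) _; last first.
    rewrite /flat_deriv hornerM hornerXn hornerD hornerN -exprVn; ring.
  near=> s; have s0 : 0 < s by near: s; exact: lt_nbhsr.
  by rewrite /flat leNgt s0.
- rewrite [X in is_derive _ _ _ X]/flat lexx.
  have [C C0 CP] := flat_bounded ('X^2 * p).
  have L : h^-1 *: (flat p (h *: 1 + 0) - flat p 0) @[h --> (0 : R)^'] --> 0.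
    have Ch : C * `|h| @[h --> (0 : R)^'] --> 0.
      rewrite -[X in _ --> X](mulr0 C); apply: cvgM; first exact: cvg_cst.
      have n0 : `|h| @[h --> (0 : R)] --> `|0 : R| by apply: cvg_norm; exact: cvg_id.
      rewrite normr0 in n0.
      exact: cvg_within_filter n0.
    apply: norm_cvg0; apply: squeeze_cvgr (cvg_cst 0) Ch.
    apply: filterS (nbhs_dnbhs_neq _) => h h0; rewrite normr_ge0 /=.
    rewrite addr0 [_%:A]mulr1 [flat p 0]/flat lexx subr0.
    have -> : flat p h = h * (h * flat ('X^2 * p) h).
      rewrite /flat; case: ifP => _; first by rewrite !mulr0.
      by rewrite hornerM hornerXn; field.
    by rewrite [_ *: _]mulrA mulVf// mul1r normrM mulrC ler_wpM2r.
  by apply: DeriveDef; [apply/cvg_ex; exists 0|exact: cvg_lim L].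
Unshelve. all: by end_near. Qed.

Section Step.
Context {n : nat} (u : 'cV[R]_n -> R).
Hypothesis u_smooth : forall k, Ck k setT u.

Let den x := flat 1 (u x) + flat 1 (1 - u x).

Let flat1_gt0 t : 0 < t -> 0 < flat 1 t.
Proof. by move=> t0; rewrite /flat leNgt t0 /= hornerE mul1r expR_gt0. Qed.

Let flat1_ge0 t : 0 <= flat 1 t.
Proof.
by have [t0|/flat1_gt0/ltW//] := leP t 0; rewrite /flat t0.
Qed.

Let den_gt0 x : 0 < den x.
Proof.
rewrite /den; have [u0|u0] := ltP 0 (u x).
  by rewrite ltr_wpDr ?flat1_ge0// flat1_gt0.
by rewrite ltr_wpDl ?flat1_ge0// flat1_gt0// subr_gt0 (le_lt_trans u0).
Qed.

(** A smooth function of [u] equal to 0 where u <= 0 and to 1 where 1 <= u. *)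
Definition step x := flat 1 (u x) * (den x)^-1.

Lemma Ck_flat k (w : 'cV[R]_n -> R) :
  (forall k, Ck k setT w) -> Ck k setT (fun x => flat 1 (w x)).
Proof.
move=> sw; apply: (@Ck_comp_family _ _ [set h | exists p, h = flat p] setT) => //.
- move=> _ [p ->]; exists (flat (flat_deriv p)); first by exists (flat_deriv p).
  by move=> t _; exact: is_derive_flat.
- exact: openT.
- by exists 1.
Qed.

Lemma Ck_inv k (w : 'cV[R]_n -> R) : (forall x, 0 < w x) ->
  (forall k, Ck k setT w) -> Ck k setT (fun x => (w x)^-1).
Proof.
move=> w0 sw.
apply: (@Ck_comp_family _ _ [set h | exists p : {poly R}, h = fun t => p.[t^-1]]
          [set t | 0 < t]) => //.
- move=> _ [p ->]; exists (fun t => (- 'X^2 * p^`()).[t^-1]).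
    by exists (- 'X^2 * p^`()).
  move=> t t0; have tn0 : t != 0 by rewrite gt_eqF.
  apply: is_derive_eq.
    exact: is_derive1_comp (is_derive_poly p _) (is_derive_inv tn0).
  rewrite hornerM hornerN hornerXn -exprVn; ring.
- exact: openT.
- by move=> x _; exact: w0.
- by exists 'X; apply/funext => t; rewrite hornerX.
Qed.

Lemma Ck_step k : Ck k setT step.
Proof.
apply: CkM; first exact: openT; first exact: Ck_flat.
apply: Ck_inv => [//|l]; apply: CkD; [exact: openT|exact: Ck_flat|].
apply: Ck_flat => m; apply: CkD; [exact: openT|apply: Ck_cst; exact: openT|].
have := CkM (@openT _) (Ck_cst m (-1) (@openT _)) (u_smooth m).
by apply: Ck_ext; [exact: openT|move=> x _; rewrite mulN1r].
Qed.

Lemma step0 x : u x <= 0 -> step x = 0.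
Proof. by move=> u0; rewrite /step {1}/flat u0 mul0r. Qed.

Lemma step1 x : 1 <= u x -> step x = 1.
Proof.
move=> u1; have := den_gt0 x; rewrite /step /den.
rewrite [flat 1 (1 - _)]/flat subr_le0 u1 addr0 => d0.
by rewrite divff// gt_eqF.
Qed.

End Step.

(** The support is described by the sup norm, since closed boxes are the compact
    sets at hand, while the bump itself is built from the Euclidean square norm,
    which is polynomial. *)
Lemma bump_exists (n : nat) (x0 : 'cV[R]_n) (r : R) : 0 < r ->
  exists chi : 'cV[R]_n -> R,
    [/\ forall k, Ck k setT chi, \forall x \near x0, chi x = 1 &
        forall (x : 'cV[R]_n) i, r <= `|x i 0 - x0 i 0| -> chi x = 0].
Proof.
move=> r0.
(* [u] is 2 at [x0] and drops to 0 on the sphere of radius [r]. *)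
pose u (x : 'cV[R]_n) : R :=
  2 + (- (2 / r ^+ 2)) * \sum_i (x i 0 + - x0 i 0) * (x i 0 + - x0 i 0).
have su k : Ck k setT u.
  have oT := @openT 'cV[R]_n.
  apply: CkD => //; first exact: Ck_cst.
  apply: CkM => //; first exact: Ck_cst.
  apply: Ck_sum => // i.
  by apply: CkM => //; apply: CkD => //; (try exact: Ck_cst); exact: Ck_coord.
exists (step u); split; first exact: Ck_step.
- have cu : u x @[x --> x0] --> u x0 by exact: Ck_continuous (su 0%N) _.
  have ux0 : u x0 = 2.
    by rewrite /u big1 ?mulr0 ?addr0// => i _; rewrite subrr mulr0.
  have u1 : \forall x \near x0, 1 < u x.
    by apply: (cvgr_gt _ cu); rewrite ux0; lra.
  apply: (@filterS _ _ (nbhs_filter x0) _ _ _ u1) => x /ltW.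
  exact: step1.
- move=> x i ri; apply: step0.
  have : r ^+ 2 <= \sum_i (x i 0 + - x0 i 0) * (x i 0 + - x0 i 0).
    rewrite (bigD1 i)//= -expr2 -[X in X <= _]addr0 lerD//.
      by rewrite -[X in _ <= X]real_normK ?num_real// lerXn2r// nnegrE ltW.
    by apply: sumr_ge0 => j _; rewrite -expr2 sqr_ge0.
  rewrite /u mulNr subr_le0 => rS.
  have r2 : 0 < r ^+ 2 by rewrite exprn_gt0.
  by rewrite mulrAC ler_pdivlMr// ler_pM2l.
Qed.

End Bump.

(** * Charts and extension of coordinate functions *)

Section Charts.
Context {R : realType} {n : nat} {M : manifold R n}.
Implicit Types (c d : chart R n M) (f : M -> R) (p q : M).
Local Notation e_ k := (delta_mx k 0 : 'cV[R]_n).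

Lemma open_chart_preimage c (U : set M) : open U ->
  open (cod c `&` psi c @^-1` U).
Proof.
move=> oU; rewrite openE => x [cx Ux].
apply: (@filterI _ _ (nbhs_filter x)).
  by apply: open_nbhs_nbhs; split=> //; exact: cod_open.
by apply: (psi_continuous cx); apply: open_nbhs_nbhs.
Qed.

Lemma open_cod c : open (cod c).
Proof. exact: cod_open. Qed.
Arguments open_cod : clear implicits.

Lemma overlap_open c d : open (cod c `&` psi c @^-1` dom d).
Proof. by apply: open_chart_preimage; exact: dom_open. Qed.
Arguments overlap_open : clear implicits.

Lemma chart_at_atlas p : atlas (chart_at p).
Proof. by rewrite /chart_at; case: cid2. Qed.

Lemma chart_at_dom p : dom (chart_at p) p.
Proof. by rewrite /chart_at; case: cid2. Qed.

Lemma smooth_fun_C1 f c x : smooth_fun f -> atlas c -> cod c x ->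
  C1_at (fun y => f (psi c y)) x.
Proof.
move=> sf ac cx.
apply: (@Ck_C1_at _ _ 0 (cod c)) => //; first exact: cod_open.
exact: (smooth_Ck 1%N (sf c ac)).
Qed.

(** [f] need only be C^1 at [p] in the chart [d], so that it may be a coordinate
    function of a chart. *)
Lemma derive_chart_change f c d p (j : 'I_n) : atlas c -> atlas d ->
  dom c p -> dom d p -> C1_at (fun y => f (psi d y)) (phi d p) ->
  'D_(e_ j) (fun x => f (psi c x)) (phi c p) =
  \sum_k 'D_(e_ k) (fun y => f (psi d y)) (phi d p) *
         jac (fun x => phi d (psi c x)) (phi c p) k j.
Proof.
move=> ac ad cp dp C1.
pose g := fun x => phi d (psi c x).
have gp : g (phi c p) = phi d p by rewrite /g phiK.
have pc : (cod c `&` psi c @^-1` dom d) (phi c p).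
  by split; [exact: phi_cod|rewrite /= phiK].
have D k : is_derive (phi c p) (e_ j) (fun x => g x k 0)
    ('D_(e_ j) (fun x => g x k 0) (phi c p)).
  apply: derivableP.
  by have [_] := atlas_compat ac ad k [::] pc; exact.
rewrite -gp in C1.
have [_] := is_derive_chain C1 D.
rewrite gp => E.
transitivity ('D_(e_ j) (fun x => f (psi d (g x))) (phi c p)).
  apply: near_eq_derive.
  apply: (open_near (overlap_open c d) pc) => x [cx dx].
  by rewrite /g phiK.
by rewrite E; apply: eq_bigr => k _; rewrite mxE.
Qed.

(** Apply [derive_chart_change] to the coordinates of the chart [d]: their
    partial derivatives in that same chart form the identity matrix. *)
Lemma jac_transitionK c d p : atlas c -> atlas d -> dom c p -> dom d p ->
  jac (fun y => phi d (psi c y)) (phi c p) *m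
  jac (fun x => phi c (psi d x)) (phi d p) = 1%:M.
Proof.
move=> ac ad cp dp; apply/matrixP => i j; rewrite !mxE.
under eq_bigr do rewrite [jac (fun y => _) _ _ _]mxE.
have dc : (cod c `&` psi c @^-1` dom d) (phi c p).
  by split; [exact: phi_cod|rewrite /= phiK].
have C1 : C1_at (fun y => phi d (psi c y) i 0) (phi c p).
  apply: Ck_C1_at (overlap_open c d) dc _.
  exact: (smooth_Ck 1%N (atlas_compat ac ad i)).
rewrite -(@derive_chart_change (fun q => phi d q i 0) d c p j) //.
have pd : cod d (phi d p) by exact: phi_cod.
transitivity ('D_(e_ j) (fun x : 'cV[R]_n => x i 0) (phi d p)).
  apply: near_eq_derive; apply: (open_near (open_cod d) pd) => x dx.
  by rewrite psiK.
by rewrite derive_coord mxE eqxx andbT eq_sym.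
Qed.

Lemma of_to_chart c x : atlas c -> cod c x ->
  of_chart c (psi c x) *m to_chart c (psi c x) = 1%:M.
Proof.
move=> ac cx; have dx := psi_dom cx.
have := jac_transitionK ac (chart_at_atlas (psi c x)) dx (chart_at_dom _).
exact.
Qed.

Lemma to_chart_at p : to_chart (chart_at p) p = 1%:M.
Proof.
apply/matrixP => i j; rewrite !mxE.
have pd : cod (chart_at p) (phi (chart_at p) p).
  exact: phi_cod (chart_at_dom p).
transitivity ('D_(e_ j) (fun x : 'cV[R]_n => x i 0) (phi (chart_at p) p)).
  apply: near_eq_derive; apply: (open_near (open_cod _) pd) => x dx.
  by rewrite psiK.
by rewrite derive_coord mxE eqxx andbT.
Qed.

Lemma loc_form_diff f c x j : smooth_fun f -> atlas c -> cod c x ->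
  loc_form c (diff_fun f) x 0 j = 'D_(e_ j) (fun y => f (psi c y)) x.
Proof.
move=> sf ac cx; have dx := psi_dom cx.
have ad := chart_at_atlas (psi c x).
have := derive_chart_change j ac ad dx (chart_at_dom (psi c x)).
rewrite {1}(psiK cx) => ->; last first.
  by apply: smooth_fun_C1 => //; exact: phi_cod (chart_at_dom _).
by rewrite /loc_form mxE; apply: eq_bigr => k _; rewrite mxE.
Qed.

Lemma smooth_form_diff f : smooth_fun f -> smooth_form (diff_fun f).
Proof.
move=> sf c ac j; apply/smooth_onP => k.
apply: (@Ck_ext _ _ k _ (fun x => 'D_(e_ j) (fun y => f (psi c y)) x)).
- exact: cod_open.
- by move=> x cx; rewrite loc_form_diff.
by have [_ /(_ j)[]] := smooth_Ck k.+1 (sf c ac).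
Qed.

Lemma compact_box (x0 : 'cV[R]_n) (r : R) :
  compact [set x : 'cV[R]_n | forall i, `|x i 0 - x0 i 0| <= r].
Proof.
pose I i := `[x0 i 0 - r, x0 i 0 + r]%classic.
have -> : [set x : 'cV[R]_n | forall i, `|x i 0 - x0 i 0| <= r] =
    trmx @` [set v : 'rV[R]_n | forall i, I i (v ord0 i)].
  apply/seteqP; split=> [x xr|_ [v vI <-] i] /=.
    exists x^T; last exact: trmxK.
    by move=> i; rewrite /I /= in_itv /= mxE -ler_distl.
  by have := vI i; rewrite /I /= in_itv /= mxE -ler_distl.
apply: continuous_compact; last first.
  by apply: rV_compact => i; exact: segment_compact.
apply: continuous_subspaceT => v.
apply: (@cvg_col _ _ _ _ (nbhs_filter v)) => i; rewrite mxE.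
under eq_fun do rewrite mxE.
exact: coord_continuous.
Qed.

(** In another chart, a point either comes from the domain of [c], where the
    extension is a smooth function composed with a change of charts, or lies off
    the support, which is compact, hence closed, so that the extension vanishes
    around the point. *)
Lemma coordinate_extension c x0 k : atlas c -> cod c x0 ->
  exists2 f, smooth_fun f & \forall x \near x0, f (psi c x) = x k 0.
Proof.
move=> ac cx0.
have /nbhs_ballP[r /= r0 rc] : nbhs x0 (cod c).
  by apply: open_nbhs_nbhs; split=> //; exact: cod_open.
have r20 : 0 < r / 2 by rewrite divr_gt0.
have [chi [schi chi1 chi0]] := bump_exists x0 r20.
(* Half the radius, so that the closed box stays inside the open ball. *)
pose K := [set x : 'cV[R]_n | forall i, `|x i 0 - x0 i 0| <= r / 2].
have Kc x : K x -> cod c x.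
  move=> Kx; apply: rc; split=> // i j; rewrite (ord1 j) /ball /= distrC.
  by apply: le_lt_trans (Kx i) _; rewrite ltr_pdivrMr// ltr_pMr// ltr1n.
have clK : closed (psi c @` K).
  apply: compact_closed; first exact: carrier_hausdorff.
  apply: continuous_compact; last exact: compact_box.
  apply: continuous_in_subspaceT => x; rewrite inE => /Kc.
  exact: psi_continuous.
pose f (q : M) := if `[< dom c q >] then chi (phi c q) * phi c q k 0 else 0.
have f0 q : ~ (psi c @` K) q -> f q = 0.
  move=> Kq; rewrite /f; case: asboolP => // cq.
  have [Kx|] := pselect (K (phi c q)).
    by case: Kq; exists (phi c q) => //; exact: phiK.
  move=> /existsNP[i /negP]; rewrite -ltNge => /ltW /chi0 ->.
  by rewrite mul0r.
exists f; last first.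
  have cn : \forall x \near x0, cod c x := open_near (open_cod c) cx0 (fun _ => id).
  apply: (@filterS2 _ _ (nbhs_filter x0) _ _ _ _ chi1 cn) => x x1 cx.
  rewrite /f; case: asboolP => [_|]; last by case; exact: psi_dom.
  by rewrite psiK// x1 mul1r.
move=> d ad s x dx.
have [cx|ncx] := pselect (dom c (psi d x)).
  pose A := cod d `&` psi d @^-1` dom c.
  have oA : open A := overlap_open d c.
  suff /smooth_onP : forall m, Ck m A (fun x => f (psi d x)) by apply.
  move=> m; apply: (@Ck_ext _ _ m _
      (fun x => chi (phi c (psi d x)) * phi c (psi d x) k 0)) => //.
    by move=> y [dy cy]; rewrite /f asboolT.
  apply: CkM => //; last exact: (smooth_Ck _ (atlas_compat ad ac k)).
  apply: (@Ck_comp _ _ m A setT chi (fun x => phi c (psi d x))) => //.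
    exact: openT.
  by move=> i; exact: (smooth_Ck _ (atlas_compat ad ac i)).
pose A := cod d `&` psi d @^-1` (~` (psi c @` K)).
have oA : open A by apply: open_chart_preimage; exact: closed_openC.
suff /smooth_onP : forall m, Ck m A (fun x => f (psi d x)).
  apply; split=> // -[y Ky ye]; apply: ncx; rewrite -ye.
  exact/psi_dom/Kc.
move=> m; apply: (@Ck_ext _ _ m _ (fun=> 0)) => //; last exact: Ck_cst.
by move=> y [_ /f0].
Qed.

End Charts.

Arguments open_cod {R n M} c.
Arguments overlap_open {R n M} c d.

(** * Linear algebra of alternating forms and of the trace identity *)

Section Alternating.
Context {F : fieldType} {n : nat} (m : ('I_n -> 'cV[F]_n) -> F).
Hypothesis m_lin : forall v i a (u w : 'cV[F]_n),
  m [eta v with i |-> a *: u + w] =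
  a * m [eta v with i |-> u] + m [eta v with i |-> w].
Hypothesis m_alt : forall (v : 'I_n -> 'cV[F]_n) i j,
  i != j -> v i = v j -> m v = 0.
Variable v : 'I_n -> 'cV[F]_n.

Let V : 'M[F]_n := \matrix_(r, j) v j r 0.

Let m_with0 i : m [eta v with i |-> 0] = 0.
Proof. by have := m_lin v i (-1) 0 0; rewrite scaler0 addr0 mulN1r addNr. Qed.

Let m_with i j : m [eta v with i |-> v j] = (i == j)%:R * m v.
Proof.
case: eqVneq => [<-|ij].
  by rewrite mul1r; congr m; apply/funext => k /=; case: eqP => // ->.
rewrite mul0r; apply: (m_alt ij) => /=.
by rewrite eqxx eq_sym (negPf ij).
Qed.

Let m_comb i (a : 'cV[F]_n) : m [eta v with i |-> V *m a] = a i 0 * m v.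
Proof.
have -> : V *m a = \sum_j a j 0 *: v j.
  apply/colP => r; rewrite summxE mxE; apply: eq_bigr => j _.
  by rewrite !mxE mulrC.
have -> : m [eta v with i |-> \sum_j a j 0 *: v j] =
    \sum_j a j 0 * m [eta v with i |-> v j].
  elim: (index_enum _) => [|j r IH]; first by rewrite !big_nil m_with0.
  by rewrite !big_cons m_lin IH.
rewrite (bigD1 i)//= m_with eqxx mul1r big1 ?addr0// => j ji.
by rewrite m_with eq_sym (negPf ji) mul0r mulr0.
Qed.

Let V_unit : m v != 0 -> V \in unitmx.
Proof.
move=> mv; rewrite unitmxE unitfE -det_tr; apply/det0P => -[a a0 aV].
have {}aV : V *m a^T = 0 by rewrite -[V]trmxK -trmx_mul aV trmx0.
(* Replacing [v i] by the null combination with coefficients [a] multiplies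
   [m v] by [a 0 i]. *)
case/negP: a0; apply/eqP/rowP => i; rewrite mxE.
have := m_comb i a^T; rewrite aV m_with0 mxE => /esym/eqP.
by rewrite mulf_eq0 (negPf mv) orbF => /eqP.
Qed.

(** If [m v] is not zero then [v] is a basis, because a linear relation between
    the [v i] would force [m v] to vanish. In that basis [J *m v i] contributes
    only through its diagonal coefficient, and the sum is the trace of a
    conjugate of [J]. *)
Lemma alternating_trace (J : 'M[F]_n) : m v != 0 ->
  \sum_i m [eta v with i |-> J *m v i] = \tr J * m v.
Proof.
move=> /V_unit Vu.
have E i : m [eta v with i |-> J *m v i] = (invmx V *m J *m V) i i * m v.
  have vi : v i = col i V by apply/colP => r; rewrite !mxE.
  have -> : J *m v i = V *m col i (invmx V *m J *m V).
    by rewrite vi !colE !mulmxA mulmxV// mul1mx.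
  by rewrite m_comb mxE.
under eq_bigr do rewrite E.
rewrite -mulr_suml; congr (_ * _).
rewrite -/(\tr (invmx V *m J *m V)) -mulmxA mxtrace_mulC.
by rewrite -mulmxA mulmxV// mulmx1.
Qed.

End Alternating.

(** The hypothesis is the compatibility of the brackets on dx_a and dx_b, taken
    along dx_j, with [dA j] and [dB j] for the derivatives of [A] and [B] in the
    direction j. Put j = b and sum over b. The terms [dA b b l * B a l] occur on
    both sides; [A a i * dB b b i] and [B b l * dA b l a] each occur twice, with
    signs that cancel by antisymmetry. What remains is the trace term and the
    left hand side of the conclusion, once on each side. *)
Lemma trace_identity (F : comNzRingType) (n : nat)
    (A B : 'I_n -> 'I_n -> F) (dA dB : 'I_n -> 'I_n -> 'I_n -> F) (a : 'I_n) :
  (forall j k l, dA j k l = - dA j l k) ->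
  (forall i j, A i j = - A j i) ->
  (forall b j,
     - (\sum_l (dA j b l * B a l + A b l * dB j a l)) =
     - (\sum_i (A b i * dB i a j + B a i * dA j b i))
     + (\sum_i A a i * (dB i b j - dB j b i)
        - \sum_l (dB j b l * A l a + B b l * dA j l a))
     - \sum_i - dA i b a * B i j) ->
  (\sum_i \sum_l dB i a l * A l i) *+ 2 = \sum_i A a i * \sum_b dB i b b.
Proof.
move=> dAN AN H.
have : \sum_b - (\sum_l (dA b b l * B a l + A b l * dB b a l)) =
  \sum_b (- (\sum_i (A b i * dB i a b + B a i * dA b b i))
     + (\sum_i A a i * (dB i b b - dB b b i)
        - \sum_l (dB b b l * A l a + B b l * dA b l a))
     - \sum_i - dA i b a * B i b) by apply: eq_bigr.
have eB b : \sum_i A a i * (dB i b b - dB b b i) =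
    \sum_i A a i * dB i b b - \sum_i A a i * dB b b i.
  by rewrite -sumrB; apply: eq_bigr => i _; rewrite mulrBr.
under eq_bigr do rewrite big_split /=.
under [RHS]eq_bigr do rewrite !big_split /= eB.
rewrite !(big_split, sumrN) /=.
set L1 := \sum_b \sum_l dA b b l * B a l.
set L2 := \sum_b \sum_l A b l * dB b a l.
set R1 := \sum_b \sum_i A b i * dB i a b.
set R2 := \sum_b \sum_i B a i * dA b b i.
set R3 := \sum_b \sum_i A a i * dB i b b.
set R4 := \sum_b \sum_i A a i * dB b b i.
set R5 := \sum_b \sum_l dB b b l * A l a.
set R6 := \sum_b \sum_l B b l * dA b l a.
set R7 := \sum_b \sum_i - dA i b a * B i b.
set S := \sum_i \sum_l dB i a l * A l i.
have -> : \sum_i A a i * \sum_b dB i b b = R3.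
  rewrite /R3 exchange_big; apply: eq_bigr => i _; exact: mulr_sumr.
have -> : R2 = L1.
  by apply: eq_bigr => b _; apply: eq_bigr => i _; rewrite mulrC.
have -> : L2 = - S.
  rewrite -sumrN; apply: eq_bigr => b _; rewrite -sumrN; apply: eq_bigr => l _.
  by rewrite AN mulNr mulrC.
have -> : R1 = S.
  rewrite /R1 exchange_big; apply: eq_bigr => i _; apply: eq_bigr => b _.
  by rewrite mulrC.
have -> : R5 = - R4.
  rewrite -sumrN; apply: eq_bigr => b _; rewrite -sumrN; apply: eq_bigr => l _.
  by rewrite AN mulrN mulrC.
have -> : R7 = - R6.
  rewrite /R7 exchange_big -sumrN; apply: eq_bigr => b _; rewrite -sumrN.
  by apply: eq_bigr => l _; rewrite mulNr mulrC.
move=> E; apply/eqP; rewrite -subr_eq0; apply/eqP.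
have -> : S *+ 2 - R3 = - (L1 - S) - (- (S + L1) + (R3 - R4 - (- R4 + R6)) + R6).
  ring.
by rewrite E; ring.
Qed.

(** * Components in a chart *)

Section LocalFormulas.
Context {R : realType} {n : nat} {M : manifold R n}.
Implicit Types (c : chart R n M) (a b : one_form M) (X : vector_field M)
  (P : bitensor_field M) (N : endo_field M) (p : M).
Local Notation e_ k := (delta_mx k 0 : 'cV[R]_n).

(** The components in a fixed chart obey the same algebra as the values, because
    [to_chart] and [of_chart] cancel. *)
Lemma loc_vector_sharp P a c x : atlas c -> cod c x ->
  loc_vector c (fun q => sharp (P q) (a q)) x =
  sharp (loc_bitensor c P x) (loc_form c a x).
Proof.
move=> ac cx; rewrite /loc_vector /loc_bitensor /loc_form /sharp.
rewrite -!mulmxA [of_chart _ _ *m _]mulmxA of_to_chart// mul1mx.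
by rewrite !trmx_mul !trmxK !mulmxA.
Qed.

Lemma loc_form_app N a c x : atlas c -> cod c x ->
  loc_form c (app_form N a) x = loc_form c a x *m loc_endo c N x.
Proof.
move=> ac cx; rewrite /loc_endo /loc_form /app_form.
by rewrite -!mulmxA [of_chart _ _ *m (_ *m _)]mulmxA of_to_chart// mul1mx.
Qed.

Lemma loc_endo_bitensor N P c x : atlas c -> cod c x ->
  loc_bitensor c (endo_bitensor N P) x =
  loc_bitensor c P x *m (loc_endo c N x)^T.
Proof.
move=> ac cx; rewrite /loc_endo /loc_bitensor /endo_bitensor.
rewrite !trmx_mul -!mulmxA; congr (_ *m (_ *m _)).
rewrite [(to_chart _ _)^T *m (_ *m _)]mulmxA -[(to_chart _ _)^T *m _]trmx_mul.
by rewrite of_to_chart// trmx1 mul1mx.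
Qed.

Lemma loc_bieval P a b c x : atlas c -> cod c x ->
  bieval (P (psi c x)) (a (psi c x)) (b (psi c x)) =
  bieval (loc_bitensor c P x) (loc_form c a x) (loc_form c b x).
Proof.
move=> ac cx; rewrite /bieval /loc_bitensor /loc_form; congr (fun_of_matrix _ 0 0).
rewrite trmx_mul -!mulmxA [of_chart _ _ *m (_ *m _)]mulmxA of_to_chart// mul1mx.
congr (_ *m (_ *m _)).
by rewrite mulmxA -trmx_mul of_to_chart// trmx1 mul1mx.
Qed.

Lemma loc_trace N c x : atlas c -> cod c x ->
  trace_fun N (psi c x) = \tr (loc_endo c N x).
Proof.
move=> ac cx; rewrite /loc_endo -mulmxA mxtrace_mulC -mulmxA of_to_chart//.
by rewrite mulmx1.
Qed.

Lemma of_chart_at p : of_chart (chart_at p) p = 1%:M.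
Proof.
have := of_to_chart (chart_at_atlas p) (phi_cod (chart_at_dom p)).
by rewrite phiK ?to_chart_at ?mulmx1//; exact: chart_at_dom.
Qed.

Lemma loc_form_at a p : loc_form (chart_at p) a (phi (chart_at p) p) = a p.
Proof.
by rewrite /loc_form phiK ?of_chart_at ?mulmx1//; exact: chart_at_dom.
Qed.

Lemma loc_endo_at N p : loc_endo (chart_at p) N (phi (chart_at p) p) = N p.
Proof.
rewrite /loc_endo phiK ?of_chart_at ?to_chart_at ?mulmx1 ?mul1mx//.
exact: chart_at_dom.
Qed.

Lemma loc_bitensor_at P p :
  loc_bitensor (chart_at p) P (phi (chart_at p) p) = P p.
Proof.
rewrite /loc_bitensor phiK ?to_chart_at ?trmx1 ?mulmx1 ?mul1mx//.
exact: chart_at_dom.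
Qed.

Lemma smooth_form_app N a : smooth_endo N -> smooth_form a ->
  smooth_form (app_form N a).
Proof.
move=> sN sa c ac j; apply/smooth_onP => k; have oc := open_cod c.
apply: (@Ck_ext _ _ k _
    (fun x => \sum_l loc_form c a x 0 l * loc_endo c N x l j)) => //.
  by move=> x cx; rewrite loc_form_app// [RHS]mxE.
apply: Ck_sum => // l; apply: CkM => //; first exact: (smooth_Ck _ (sa c ac l)).
exact: (smooth_Ck _ (sN c ac l j)).
Qed.

Lemma smooth_endo_bitensor N P : smooth_endo N -> smooth_bitensor P ->
  smooth_bitensor (endo_bitensor N P).
Proof.
move=> sN sP c ac i j; apply/smooth_onP => k; have oc := open_cod c.
apply: (@Ck_ext _ _ k _
    (fun x => \sum_l loc_bitensor c P x i l * loc_endo c N x j l)) => //.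
  move=> x cx; rewrite loc_endo_bitensor// [RHS]mxE.
  by apply: eq_bigr => l _; rewrite [_^T l j]mxE.
apply: Ck_sum => // l; apply: CkM => //; first exact: (smooth_Ck _ (sP c ac i l)).
exact: (smooth_Ck _ (sN c ac j l)).
Qed.

Lemma derive_partials (f : 'cV[R]_n -> R) (x v : 'cV[R]_n) : C1_at f x ->
  is_derive x v f (\sum_k v k 0 * 'D_(e_ k) f x).
Proof.
move=> C1; apply: is_derive_eq (is_derive_chain (g := id) C1 _) _.
  by move=> k; exact: is_derive_coord.
by apply: eq_bigr => k _; rewrite mulrC.
Qed.

Lemma derive_sumM (f g : 'I_n -> 'cV[R]_n -> R) (x v : 'cV[R]_n) :
  (forall i, derivable (f i) x v) -> (forall i, derivable (g i) x v) ->
  is_derive x v (fun y => \sum_i f i y * g i y)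
    (\sum_i ('D_v (f i) x * g i x + f i x * 'D_v (g i) x)).
Proof.
move=> df dg.
have -> : (fun y => \sum_i f i y * g i y) = \sum_i (fun y => f i y * g i y).
  by apply/funext => y; rewrite fct_sumE.
apply: is_derive_sum => i.
apply: is_derive_eq (is_deriveM (derivableP (df i)) (derivableP (dg i))) _.
by rewrite addrC -[g i x *: _]/(g i x * _) mulrC.
Qed.

End LocalFormulas.

(** * Brackets of 1-forms and modular fields in coordinates *)

Section PointFormulas.
Context {R : realType} {n : nat} {M : manifold R n}.
Implicit Types (a b : one_form M) (X : vector_field M)
  (P : bitensor_field M) (N : endo_field M).
Variable p : M.
Local Notation e_ k := (delta_mx k 0 : 'cV[R]_n).
Local Notation c := (chart_at p).
Local Notation x0 := (phi (chart_at p) p).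
Local Notation d_ i f := ('D_(delta_mx i 0) f x0).

Let ac : atlas c := chart_at_atlas p.
Let cx0 : cod c x0 := phi_cod (chart_at_dom p).

Lemma smooth_on_C1 (f : 'cV[R]_n -> R) : smooth_on (cod c) f -> C1_at f x0.
Proof.
move=> sf; apply: (@Ck_C1_at _ _ 0 (cod c)) => //; first exact: open_cod.
exact: smooth_Ck.
Qed.

Lemma smooth_on_derive (f : 'cV[R]_n -> R) (v : 'cV[R]_n) :
  smooth_on (cod c) f -> is_derive x0 v f (\sum_k v k 0 * d_ k f).
Proof. by move=> sf; exact/derive_partials/smooth_on_C1. Qed.

Lemma smooth_on_derivable (f : 'cV[R]_n -> R) (v : 'cV[R]_n) :
  smooth_on (cod c) f -> derivable f x0 v.
Proof. by move=> sf; have [] := smooth_on_derive v sf. Qed.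

(** The components of the vector field [sharp P a] in the chart [chart_at p]. *)
Definition contract P a (i : 'I_n) (x : 'cV[R]_n) : R :=
  \sum_l loc_form c a x 0 l * loc_bitensor c P x l i.

Lemma smooth_contract P a i : smooth_bitensor P -> smooth_form a ->
  smooth_on (cod c) (contract P a i).
Proof.
move=> sP sa; apply/smooth_onP => k.
have oc := open_cod c; apply: Ck_sum => // l.
apply: CkM => //; first exact: (smooth_Ck _ (sa c ac l)).
exact: (smooth_Ck _ (sP c ac l i)).
Qed.

Lemma sharp_contract P a x i :
  sharp (loc_bitensor c P x) (loc_form c a x) i 0 = contract P a i x.
Proof. by rewrite /sharp [LHS]mxE [LHS]mxE. Qed.

Lemma near_cod (Q : 'cV[R]_n -> Prop) :
  (forall x, cod c x -> Q x) -> \forall x \near x0, Q x.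
Proof. exact: open_near (open_cod c) cx0. Qed.

Lemma lie_form_sharp P a b j :
  smooth_bitensor P -> smooth_form a -> smooth_form b ->
  lie_form (fun q => sharp (P q) (a q)) b p 0 j =
  \sum_i contract P a i x0 * d_ i (fun x => loc_form c b x 0 j) +
  \sum_i loc_form c b x0 0 i * d_ j (contract P a i).
Proof.
move=> sP sa sb; rewrite /lie_form mxE; congr (_ + _).
  rewrite derive_mx; last first.
    apply/derivable_mxP => i k; rewrite (ord1 i).
    exact: smooth_on_derivable (sb c ac k).
  rewrite mxE; have [_ ->] := smooth_on_derive (sharp (P p) (a p)) (sb c ac j).
  apply: eq_bigr => i _; rewrite -sharp_contract.
  by rewrite loc_bitensor_at loc_form_at.
rewrite -{1}(loc_form_at b p) [LHS]mxE; apply: eq_bigr => i _; congr (_ * _).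
rewrite mxE; apply: near_eq_derive; apply: near_cod => x cx.
by rewrite loc_vector_sharp// sharp_contract.
Qed.

(** The derivatives of the components of [sharp P a] cancel between the first
    Lie derivative and the differential of P(a, b). *)
Lemma form_bracketE P a b j :
  smooth_bitensor P -> smooth_form a -> smooth_form b ->
  form_bracket P a b p 0 j =
  \sum_i contract P a i x0 *
    (d_ i (fun x => loc_form c b x 0 j) - d_ j (fun x => loc_form c b x 0 i)) -
  \sum_i (contract P b i x0 * d_ i (fun x => loc_form c a x 0 j) +
          loc_form c a x0 0 i * d_ j (contract P b i)).
Proof.
move=> sP sa sb; rewrite /form_bracket.
rewrite [LHS]mxE [X in X + _ = _]mxE [X in _ + X = _]mxE [X in _ + X + _ = _]mxE.
rewrite !lie_form_sharp//.
have -> : diff_fun (fun q => bieval (P q) (a q) (b q)) p 0 j =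
    \sum_i (loc_form c b x0 0 i * d_ j (contract P a i) +
      contract P a i x0 * d_ j (fun x => loc_form c b x 0 i)).
  rewrite mxE.
  transitivity (d_ j (fun x => \sum_i contract P a i x * loc_form c b x 0 i)).
    apply: near_eq_derive; apply: near_cod => x cx.
    rewrite loc_bieval// /bieval [LHS]mxE; apply: eq_bigr => i _.
    by rewrite [_^T _ _]mxE; congr (_ * _); rewrite [LHS]mxE.
  have [||_ ->] := @derive_sumM R n (contract P a) (fun i x => loc_form c b x 0 i)
    x0 (e_ j).
  - by move=> i; exact/smooth_on_derivable/smooth_contract.
  - by move=> i; exact: smooth_on_derivable (sb c ac i).
  by apply: eq_bigr => i _; rewrite [X in X + _ = _]mulrC.
rewrite big_split /= [in RHS]big_split /=.
under [in RHS]eq_bigr do rewrite mulrBr.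
rewrite sumrB.
ring.
Qed.

Lemma sum_kronecker (k : 'I_n) (F : 'I_n -> R) :
  \sum_i (k == i)%:R * F i = F k.
Proof.
rewrite (bigD1 k)//= eqxx mul1r big1 ?addr0// => l lk.
by rewrite eq_sym (negPf lk) mul0r.
Qed.

(** Only the germ at [p] is prescribed: [a] is the differential of the [k]-th
    coordinate near [p]. *)
Definition coordinate_form (k : 'I_n) a :=
  \forall x \near x0, forall i, loc_form c a x 0 i = (k == i)%:R.

Lemma coordinate_form_exists k :
  exists2 f, smooth_fun f & coordinate_form k (diff_fun f).
Proof.
have [f sf fx] := coordinate_extension k ac cx0.
exists f => //; have fxx := nbhs_interior fx.
apply: (@filterS2 _ _ (nbhs_filter x0) _ _ _ _ fxx (near_cod (fun x cx => cx))).
move=> x fy cx i; rewrite loc_form_diff//.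
by rewrite (near_eq_derive _ fy) derive_coord mxE eqxx andbT.
Qed.

Lemma contract_coordinate k a P : coordinate_form k a ->
  \forall x \near x0, forall i, contract P a i x = loc_bitensor c P x k i.
Proof.
apply: (@filterS _ _ (nbhs_filter x0)) => x ak i; rewrite /contract.
under eq_bigr do rewrite ak.
exact: sum_kronecker.
Qed.

Lemma loc_form_app_coordinate k a N : coordinate_form k a ->
  \forall x \near x0, forall i,
    loc_form c (app_form N a) x 0 i = loc_endo c N x k i.
Proof.
move=> ak; apply: (@filterS2 _ _ (nbhs_filter x0) _ _ _ _ ak
  (near_cod (fun x cx => cx))) => x akx cx i.
rewrite loc_form_app// [LHS]mxE.
under eq_bigr do rewrite akx.
exact: sum_kronecker.
Qed.

Lemma near_derive (T : Type) (f g : T -> 'cV[R]_n -> R) (v : 'cV[R]_n) :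
  (\forall x \near x0, forall t, f t x = g t x) ->
  forall t, 'D_v (f t) x0 = 'D_v (g t) x0.
Proof.
move=> fg t; apply: near_eq_derive.
by apply: (@filterS _ _ (nbhs_filter x0) _ _ _ fg) => x; exact.
Qed.

Lemma derive_coordinate_form k a v j : coordinate_form k a ->
  'D_v (fun x => loc_form c a x 0 j) x0 = 0.
Proof.
move=> ak; rewrite (near_derive (f := fun i x => loc_form c a x 0 i)
  (g := fun i => cst (k == i)%:R) v ak j).
exact: derive_cst.
Qed.

(** Test the divergence on a function equal to the [k]-th coordinate near [p].
    Its hamiltonian field is the [k]-th row of [P], so the trace of the Jacobian
    is the divergence of that row; the derivative of the density of [mu] gives
    the other term, in which [lam] is the logarithmic gradient of the density.
    What matters later is that [lam] depends on [mu] alone. *)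
Lemma modular_fieldE (mu : top_form M) : volume_form mu ->
  exists lam : 'I_n -> R, forall P X, smooth_bitensor P ->
    modular_field P mu X -> forall k,
    X p k 0 = \sum_i (d_ i (fun x => loc_bitensor c P x k i) + P p k i * lam i).
Proof.
move=> [smu mlin malt mn0]; have [v mv] := mn0 p.
(* Up to a constant, the density of [mu] in the chart is its value on any frame
   [v] with constant components, as long as that value is not zero at [p]. *)
exists (fun i => d_ i (fun x => loc_top c mu x v) / mu p v) => P X sP [_ dX] k.
have [f sf fk] := coordinate_form_exists k.
have fkP := contract_coordinate P fk.
have := dX f sf p v.
have -> : pairing (diff_fun f p) (X p) = X p k 0.
  rewrite /pairing [LHS]mxE -(loc_form_at (diff_fun f) p).
  under eq_bigr do rewrite (nbhs_singleton fk).
  exact: sum_kronecker.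
rewrite /lie_top (alternating_trace (mlin p) (malt p) _ mv) => E.
apply: (mulIf mv); rewrite -E mulr_suml.
have [_ ->] := smooth_on_derive (ham_field P f p) (smu c ac v).
rewrite /mxtrace mulr_suml -big_split; apply: eq_bigr => i _ /=.
rewrite mulrDl addrC -mulrA divfK//; congr (_ * _ + _ * _).
  rewrite mxE; apply: near_eq_derive.
  apply: (@filterS2 _ _ (nbhs_filter x0) _ _ _ _ fkP (near_cod (fun x cx => cx))).
  by move=> x <- cx; rewrite loc_vector_sharp// sharp_contract.
rewrite /ham_field -(loc_bitensor_at P p) -(loc_form_at (diff_fun f) p).
by rewrite sharp_contract (nbhs_singleton fkP).
Qed.

End PointFormulas.

(** * The trace identity of a Poisson-Nijenhuis structure *)

Section Identity.
Context {R : realType} {n : nat} {M : manifold R n}.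
Implicit Types (a b : one_form M) (P : bitensor_field M) (N : endo_field M).
Variable p : M.
Local Notation e_ k := (delta_mx k 0 : 'cV[R]_n).
Local Notation c := (chart_at p).
Local Notation x0 := (phi (chart_at p) p).
Local Notation d_ i f := ('D_(delta_mx i 0) f x0).

Let ac : atlas c := chart_at_atlas p.

Lemma derive_loc_endo_bitensor P N k i (v : 'cV[R]_n) :
  smooth_bitensor P -> smooth_endo N ->
  'D_v (fun x => loc_bitensor c (endo_bitensor N P) x k i) x0 =
  \sum_l ('D_v (fun x => loc_bitensor c P x k l) x0 * N p i l +
          P p k l * 'D_v (fun x => loc_endo c N x i l) x0).
Proof.
move=> sP sN.
transitivity ('D_v (fun x =>
    \sum_l loc_bitensor c P x k l * loc_endo c N x i l) x0).
  apply: near_eq_derive; apply: near_cod => x cx.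
  rewrite loc_endo_bitensor// [LHS]mxE.
  by apply: eq_bigr => l _; rewrite [_^T l i]mxE.
have [||_ ->] := @derive_sumM R n (fun l x => loc_bitensor c P x k l)
    (fun l x => loc_endo c N x i l) x0 v.
- by move=> l; exact: smooth_on_derivable (sP c ac k l).
- by move=> l; exact: smooth_on_derivable (sN c ac i l).
by rewrite loc_bitensor_at loc_endo_at.
Qed.

Lemma bracket_coordinate P k l a b j : smooth_bitensor P ->
  smooth_form a -> smooth_form b ->
  coordinate_form p k a -> coordinate_form p l b ->
  form_bracket P a b p 0 j = - d_ j (fun x => loc_bitensor c P x l k).
Proof.
move=> sP sa sb ak bl; rewrite form_bracketE//.
rewrite [X in X - _ = _]big1 => [|i _]; last first.
  by rewrite !(derive_coordinate_form _ _ bl) subrr mulr0.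
rewrite sub0r; congr (- _).
under eq_bigr do rewrite (derive_coordinate_form _ _ ak) mulr0 add0r
  (nbhs_singleton ak) (near_derive _ (contract_coordinate P bl)).
exact: sum_kronecker.
Qed.

Lemma bracket_coordinate_l P N k l a b j :
  smooth_bitensor P -> smooth_endo N ->
  smooth_form a -> smooth_form b ->
  coordinate_form p k a -> coordinate_form p l b ->
  form_bracket P (app_form N a) b p 0 j =
  - \sum_i (P p l i * d_ i (fun x => loc_endo c N x k j) +
            N p k i * d_ j (fun x => loc_bitensor c P x l i)).
Proof.
move=> sP sN sa sb ak bl; rewrite form_bracketE//; last exact: smooth_form_app.
rewrite [X in X - _ = _]big1 => [|i _]; last first.
  by rewrite !(derive_coordinate_form _ _ bl) subrr mulr0.
rewrite sub0r; congr (- _); apply: eq_bigr => i _.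
have aN := loc_form_app_coordinate N ak; have bP := contract_coordinate P bl.
rewrite (nbhs_singleton aN) (nbhs_singleton bP) (near_derive _ bP).
rewrite (near_derive (f := fun i x => loc_form c (app_form N a) x 0 i) _ aN).
by rewrite loc_bitensor_at loc_endo_at.
Qed.

Lemma bracket_coordinate_r P N k l a b j :
  smooth_bitensor P -> smooth_endo N ->
  smooth_form a -> smooth_form b ->
  coordinate_form p k a -> coordinate_form p l b ->
  form_bracket P a (app_form N b) p 0 j =
  \sum_i P p k i * (d_ i (fun x => loc_endo c N x l j) -
                    d_ j (fun x => loc_endo c N x l i)) -
  \sum_i (d_ j (fun x => loc_endo c N x l i) * P p i k +
          N p l i * d_ j (fun x => loc_bitensor c P x i k)).
Proof.
move=> sP sN sa sb ak bl; rewrite form_bracketE//; last exact: smooth_form_app.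
have aP := contract_coordinate P ak; have bN := loc_form_app_coordinate N bl.
congr (_ - _).
  apply: eq_bigr => i _; rewrite (nbhs_singleton aP) loc_bitensor_at.
  by rewrite !(near_derive (f := fun i x => loc_form c (app_form N b) x 0 i) _ bN).
under eq_bigr do rewrite (derive_coordinate_form _ _ ak) mulr0 add0r
  (nbhs_singleton ak).
rewrite sum_kronecker.
transitivity (d_ j (fun x => \sum_i loc_endo c N x l i * loc_bitensor c P x i k)).
  apply: near_eq_derive; apply: (@filterS _ _ (nbhs_filter x0) _ _ _ bN) => x bNx.
  by apply: eq_bigr => i _; rewrite bNx.
have [||_ ->] := @derive_sumM R n (fun i x => loc_endo c N x l i)
    (fun i x => loc_bitensor c P x i k) x0 (e_ j).
- by move=> i; exact: smooth_on_derivable (sN c ac l i).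
- by move=> i; exact: smooth_on_derivable (sP c ac i k).
by rewrite loc_bitensor_at loc_endo_at.
Qed.

Lemma bitensor_antisym P : (forall q u v, bieval (P q) u v = - bieval (P q) v u) ->
  forall q, (P q)^T = - P q.
Proof.
move=> aP q; apply/matrixP => i j; rewrite !mxE.
have := aP q (delta_mx 0 j) (delta_mx 0 i).
by rewrite /bieval -!rowE !trmx_delta -!colE !mxE.
Qed.

Lemma loc_bitensor_antisym P : (forall q, (P q)^T = - P q) ->
  forall x i j, loc_bitensor c P x i j = - loc_bitensor c P x j i.
Proof.
move=> aP x i j.
have entry (A : 'M[R]_n) : A^T = - A -> A i j = - A j i.
  by move=> /matrixP/(_ j i); rewrite !mxE.
by apply: entry; rewrite /loc_bitensor !trmx_mul trmxK aP mulmxA mulmxN mulNmx.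
Qed.

(** The three brackets in the compatibility condition, evaluated on coordinate
    forms, are the three brackets of [trace_identity]. *)
Lemma nijenhuis_trace P N : poisson_nijenhuis P N -> forall k,
  (\sum_i \sum_l d_ i (fun x => loc_endo c N x k l) * P p l i) *+ 2 =
  \sum_i P p k i * \sum_m d_ i (fun x => loc_endo c N x m m).
Proof.
move=> [[sP aP _] sN _ _ bracketN] k.
have PT := bitensor_antisym aP; have locT := loc_bitensor_antisym PT.
have T := @trace_identity R n (P p) (N p)
  (fun j m l => d_ j (fun x => loc_bitensor c P x m l))
  (fun j m l => d_ j (fun x => loc_endo c N x m l)) k.
apply: T => [j m l|i j|m j].
- have dlm := @smooth_on_derivable _ _ _ p _ (e_ j) (sP c ac l m).
  have [_ <-] := is_deriveN (derivableP dlm).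
  by congr (d_ j _); apply/funext => x; exact: locT.
- by have := locT x0 i j; rewrite loc_bitensor_at.
have [f sf fk] := coordinate_form_exists p k.
have [g sg gm] := coordinate_form_exists p m.
have df := smooth_form_diff sf; have dg := smooth_form_diff sg.
have /(congr1 (fun w : 'rV[R]_n => w 0 j)) := bracketN _ _ df dg p.
rewrite [X in _ = X -> _]mxE [X in _ = X + _ -> _]mxE [X in _ = _ + X -> _]mxE.
rewrite [app_form N _ p 0 j]mxE.
rewrite (bracket_coordinate j (smooth_endo_bitensor sN sP) df dg fk gm).
rewrite (bracket_coordinate_l j sP sN df dg fk gm).
rewrite (bracket_coordinate_r j sP sN df dg fk gm).
under [X in _ = _ - X -> _]eq_bigr do
  rewrite (bracket_coordinate _ sP df dg fk gm).
by rewrite derive_loc_endo_bitensor.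
Qed.

(** The bivector pi_1 is P N^T by definition; writing it as N P makes the
    derivative of pi_1 produce N applied to the derivative of P, which is the
    term that N X^0 cancels. *)
Lemma loc_endo_bitensorC P N x :
  (forall q, P q *m (N q)^T = N q *m P q) -> cod c x ->
  loc_bitensor c (endo_bitensor N P) x = loc_endo c N x *m loc_bitensor c P x.
Proof.
move=> PN cx; rewrite /loc_endo /loc_bitensor /endo_bitensor PN -!mulmxA.
by rewrite [of_chart _ _ *m (_ *m _)]mulmxA of_to_chart// mul1mx.
Qed.

Lemma derive_trace N (h : R) i : smooth_endo N ->
  diff_fun (fun q => h * trace_fun N q) p 0 i =
  h * \sum_m d_ i (fun x => loc_endo c N x m m).
Proof.
move=> sN; rewrite mxE.
transitivity (d_ i (fun x => \sum_m cst h x * loc_endo c N x m m)).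
  apply: near_eq_derive; apply: near_cod => x cx.
  by rewrite loc_trace// mulr_sumr.
have [||_ ->] := @derive_sumM R n (fun m => cst h) (fun m x => loc_endo c N x m m)
    x0 (e_ i).
- by move=> m; exact: derivable_cst.
- by move=> m; exact: smooth_on_derivable (sN c ac m m).
by rewrite mulr_sumr; apply: eq_bigr => m _; rewrite derive_cst mul0r add0r.
Qed.

(** The terms in the logarithmic gradient of the density and in the derivative
    of [P] are the same in both modular fields, up to [N]. *)
Lemma modular_difference P N (mu : top_form M) (X0 X1 : vector_field M) k :
  poisson_nijenhuis P N -> volume_form mu ->
  modular_field P mu X0 -> modular_field (endo_bitensor N P) mu X1 ->
  (X1 p - N p *m X0 p) k 0 =
  \sum_i \sum_l d_ i (fun x => loc_endo c N x k l) * P p l i.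
Proof.
move=> [[sP _ _] sN _ NP _] hmu hX0 hX1.
have PN q : P q *m (N q)^T = N q *m P q.
  apply/row_matrixP => i; have := NP q (delta_mx 0 i).
  rewrite /sharp -[N q in LHS]trmxK -trmx_mul => /trmx_inj.
  by rewrite !rowE !mulmxA.
have [lam modE] := modular_fieldE p hmu.
rewrite [LHS]mxE [X in _ + X = _]mxE [(N p *m X0 p) k 0]mxE.
rewrite (modE _ _ (smooth_endo_bitensor sN sP) hX1).
under [X in _ - X = _]eq_bigr do rewrite (modE _ _ sP hX0) mulr_sumr.
rewrite [X in _ - X = _]exchange_big -sumrB; apply: eq_bigr => i _.
have -> : d_ i (fun x => loc_bitensor c (endo_bitensor N P) x k i) =
    \sum_l (d_ i (fun x => loc_endo c N x k l) * P p l i +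
            N p k l * d_ i (fun x => loc_bitensor c P x l i)).
  transitivity (d_ i (fun x =>
      \sum_l loc_endo c N x k l * loc_bitensor c P x l i)).
    apply: near_eq_derive; apply: near_cod => x cx.
    by rewrite loc_endo_bitensorC// [LHS]mxE.
  have [||_ ->] := @derive_sumM R n (fun l x => loc_endo c N x k l)
      (fun l x => loc_bitensor c P x l i) x0 (e_ i).
  - by move=> l; exact: smooth_on_derivable (sN c ac k l).
  - by move=> l; exact: smooth_on_derivable (sP c ac l i).
  by rewrite loc_bitensor_at loc_endo_at.
rewrite /endo_bitensor PN [(N p *m P p) k i]mxE mulr_suml -big_split -sumrB /=.
by apply: eq_bigr => l _; ring.
Qed.

End Identity.

Theorem theorem1 (R : realType) (n : nat) (M : manifold R n)
    (pi0 : bitensor_field M) (N : endo_field M)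
    (hPN : poisson_nijenhuis pi0 N)
    (mu : top_form M) (hmu : volume_form mu)
    (X0 X1 : vector_field M)
    (hX0 : modular_field pi0 mu X0)
    (hX1 : modular_field (endo_bitensor N pi0) mu X1) :
  (fun p => X1 p - N p *m X0 p) =
  ham_field pi0 (fun p => - (1 / 2%:R) * trace_fun N p).
Proof.
apply/funext => p; apply/colP => k.
rewrite (modular_difference p k hPN hmu hX0 hX1).
have := nijenhuis_trace p hPN k; set S := \sum_i _ => S2.
have [[_ aP _] sN _ _ _] := hPN.
have -> : S = 2^-1 * (S *+ 2) by rewrite -[S *+ 2]mulr_natl mulKf ?pnatr_eq0.
rewrite S2 /ham_field /sharp [RHS]mxE [RHS]mxE mulr_sumr.
apply: eq_bigr => i _; rewrite derive_trace// mul1r.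
have /matrixP/(_ k i) := bitensor_antisym aP p; rewrite !mxE => ->.
ring.
Qed.
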